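(* Let $p\ge1$, $\mathbf m=(m_1,\ldots,m_p)\in\mathbb N^p$, $n\in\mathbb N$, and $x\in\mathbb C$ with $|x|\le 1$ and $(m_p,x)\neq(1,1)$. Then \[ n\int_0^x t^{n-1}dt\,\frac{dt}{1-t}\Big(\frac{dt}{t}\Big)^{m_1-1}\frac{dt}{1-t}\Big(\frac{dt}{t}\Big)^{m_2-1}\cdots\frac{dt}{1-t}\Big(\frac{dt}{t}\Big)^{m_p-1} =(-1)^p\,\zeta^\star_n(m_1,\ldots,m_p;\underbrace{1,\ldots,1}_{p-1},x)-\sum_{j=1}^{p}(-1)^{j}\,\zeta^\star_n(m_1,\ldots,m_{j-1})\,\mathrm{Li}_{m_p,m_{p-1},\ldots,m_j}(x). \]
   Context: Iterated integrals: $\int_a^b f_q(t)dt\,f_{q-1}(t)dt\cdots f_1(t)dt:=\int_{a<t_q<\cdots<t_1<b}f_q(t_q)\cdots f_1(t_1)\,dt_1\cdots dt_q$ (the leftmost form carries the smallest variable), taken along the straight segment from $a$ to $b$ when $a,b$ are complex; $(dt/t)^{0}$ means the form is absent. For a composition $\mathbf k=(k_1,\ldots,k_r)$, variables $\mathbf x=(x_1,\ldots,x_r)$ and $n\in\mathbb N$: $\zeta^\star_n(\mathbf k;\mathbf x)=\sum_{n\ge n_1\ge\cdots\ge n_r\ge1}\prod_{i}x_i^{n_i}/n_i^{k_i}$, $\zeta^\star_n(\mathbf k)=\zeta^\star_n(\mathbf k;1,\ldots,1)$, and $\zeta^\star_n(\emptyset)=1$. The single-variable multiple polylogarithm is $\mathrm{Li}_{k_1,\ldots,k_r}(x)=\sum_{n_1>\cdots>n_r>0}x^{n_1}/(n_1^{k_1}\cdots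 n_r^{k_r})$. *)

(* Defs.v *)
From HB Require Import structures.
From mathcomp Require Import all_boot all_order all_algebra.
From mathcomp Require Import all_classical all_reals all_analysis.
From mathcomp Require Import complex.
Import Order.TTheory GRing.Theory Num.Theory.
Import numFieldNormedType.Exports.

Set Implicit Arguments.
Unset Strict Implicit.
Unset Printing Implicit Defensive.

Local Open Scope ring_scope.
Local Open Scope complex_scope.

Section Defs.
Variable R : realType.
Local Notation C := R[i].

Definition cintegral (f : R -> C) (u : R) : C :=
  (Rintegral lebesgue_measure `[0, u] (fun s => complex.Re (f s)))%:C
  + 'i * (Rintegral lebesgue_measure `[0, u] (fun s => complex.Im (f s)))%:C.

(* nested_int x [:: w_1; w_2; ...; w_q] u
     = \int_{0 < s_q < ... < s_1 < u} prod_i x * w_i (x s_i) ds,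
   i.e. the iterated integral along the segment t = x s, s in [0,u],
   with w_1 attached to the LARGEST variable (outermost integral). *)
Fixpoint nested_int (x : C) (ws : seq (C -> C)) (u : R) : C :=
  match ws with
  | [::] => 1
  | w :: ws' => cintegral (fun s => x * w (x * s%:C) * nested_int x ws' s) u
  end.

(* Iterated integral  \int_0^x f_q(t)dt f_{q-1}(t)dt ... f_1(t)dt  (paper's
   convention: the LEFTMOST form carries the SMALLEST variable), taken along
   the straight segment from 0 to x.  [fs] lists the forms left to right:
   fs = [:: f_q; ...; f_1]. *)
Definition iterated_integral (x : C) (fs : seq (C -> C)) : C :=
  nested_int x (rev fs) 1.

Definition form_pow (n : nat) : C -> C := fun t => t ^+ n.-1.
Definition form_one_minus : C -> C := fun t => (1 - t)^-1.
Definition form_t : C -> C := fun t => t^-1.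

Definition block (m : nat) : seq (C -> C) := form_one_minus :: nseq m.-1 form_t.

Definition main_forms (n : nat) (ms : seq nat) : seq (C -> C) :=
  form_pow n :: flatten (map block ms).

Fixpoint zeta_star_n (n : nat) (ky : seq (nat * C)) : C :=
  match ky with
  | [::] => 1
  | (k, y) :: ky' =>
      \sum_(1 <= a < n.+1) y ^+ a / (a%:R ^+ k) * zeta_star_n a ky'
  end.

Definition zeta_star_n1 (n : nat) (ks : seq nat) : C :=
  zeta_star_n n (map (fun k => (k, 1)) ks).

Fixpoint zeta_n (n : nat) (ks : seq nat) : C :=
  match ks with
  | [::] => 1
  | k :: ks' => \sum_(1 <= a < n.+1) (a%:R ^+ k)^-1 * zeta_n a.-1 ks'
  end.

Definition Li_trunc (N : nat) (ks : seq nat) (x : C) : C :=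
  match ks with
  | [::] => 1
  | k :: ks' => \sum_(1 <= a < N.+1) x ^+ a / (a%:R ^+ k) * zeta_n a.-1 ks'
  end.

Definition Li (ks : seq nat) (x : C) : C :=
  (limn (fun N : nat => complex.Re (Li_trunc N ks x) : R^o))%:C
  + 'i * (limn (fun N : nat => complex.Im (Li_trunc N ks x) : R^o))%:C.

End Defs.

Arguments cintegral {R}.
Arguments nested_int {R}.
Arguments iterated_integral {R}.
Arguments form_pow {R}.
Arguments form_one_minus {R}.
Arguments form_t {R}.
Arguments block {R}.
Arguments main_forms {R}.
Arguments zeta_star_n {R}.
Arguments zeta_star_n1 {R}.
Arguments zeta_n {R}.
Arguments Li_trunc {R}.
Arguments Li {R}.

(* Main.v *)
(* Along the segment t = x s every nested integral is a power series in t with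
   nonnegative real coefficients c_k. Integrating against dt/t replaces c_k by
   c_k / k, and integrating against dt/(1-t) replaces it by the average
   (sum_(j < k) c_j) / k. Both operations preserve 0 <= c_k <= 1 and
   sum_k c_k / k <= 1, and this weighted sum is exactly what dominates the
   partial sums, so dominated convergence applies up to and including the
   endpoint s = 1. For dt/(1-t) the domination comes from
     (1 - t) sum_(k < N) S_(k+1) t^k = sum_(k < N) c_k t^k - S_N t^N,
   S_k = sum_(j < k) c_j, together with |1 - x s| >= d > 0 when x <> 1; this
   also gives the convergence of Li on the unit circle. What remains is an
   identity between partial sums: with A(n; m_1, ..., m_p) the sum of
   x^(k_p) / (k_1^(m_1) ... k_p^(m_p)) over N > k_p > ... > k_1 > n,
     A(n; m_1, ..., m_p) - A(n+1; m_1, ..., m_p)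
       = A(n+1; m_2, ..., m_p) / (n+1)^(m_1),
   which telescopes down to n = 0, where A is a truncation of Li. *)
Require Import Defs.
From HB Require Import structures.
From mathcomp Require Import all_boot all_order all_algebra.
From mathcomp Require Import all_classical all_reals all_analysis.
From mathcomp Require Import measurable_realfun complex ring lra.
Import Order.TTheory GRing.Theory Num.Theory.
Import numFieldNormedType.Exports.

Set Implicit Arguments.
Unset Strict Implicit.
Unset Printing Implicit Defensive.

Local Open Scope ring_scope.

(** * Termwise integration of real power series *)

Section PowerSumIntegral.
Local Open Scope classical_set_scope.
Variable R : realType.
Local Notation mu := (@lebesgue_measure R).

Lemma is_derive_power_sum (a : nat -> R) N (s : R) :
  is_derive s 1 (fun t => \sum_(k < N) a k / k.+1%:R * t ^+ k.+1)
    (\sum_(k < N) a k * s ^+ k).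
Proof.
elim: N => [|N IH].
  under eq_fun do rewrite big_ord0.
  by rewrite big_ord0; exact: is_derive_cst.
under eq_fun do rewrite big_ord_recr /=.
rewrite big_ord_recr /=.
apply: is_deriveD.
rewrite (_ : (fun x => _) = (a N / N.+1%:R) \*: (@idfun R ^+ N.+1)); last first.
  by apply/funext => t /=; rewrite exprfctE.
apply: is_derive_eq.
rewrite /GRing.scale /= -mulr_natl mulr1.
by field; rewrite addrC natr1 pnatr_eq0.
Qed.

Lemma continuous_power_sum (a : nat -> R) N :
  continuous (fun t : R => \sum_(k < N) a k * t ^+ k).
Proof.
move=> t; elim: N => [|N IH].
  by under eq_fun do rewrite big_ord0; exact: cvg_cst.
under eq_fun do rewrite big_ord_recr /=.
apply: cvgD => //; apply: cvgM; first exact: cvg_cst.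
exact: exprn_continuous.
Qed.

Lemma measurable_power_sum (a : nat -> R) N (D : set R) :
  measurable_fun D (fun t : R => \sum_(k < N) a k * t ^+ k).
Proof.
apply: measurable_funTS; apply: continuous_measurable_fun.
exact: continuous_power_sum.
Qed.

Lemma integral_power_sum (a : nat -> R) N (u : R) : 0 <= u ->
  (\int[mu]_(s in `[0%R, u]) (\sum_(k < N) a k * s ^+ k)%:E =
   (\sum_(k < N) a k / k.+1%:R * u ^+ k.+1)%:E)%E.
Proof.
(* The degenerate interval u = 0 is split off: the fundamental theorem of calculus is applied for 0
   < u. *)
rewrite le_eqVlt => /predU1P[<-|u0].
  rewrite set_itv1 integral_set1 big1 // => k _.
  by rewrite expr0n mulr0.
pose F (t : R) := \sum_(k < N) a k / k.+1%:R * t ^+ k.+1.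
have dF (s : R) : derivable F s 1 by case: (is_derive_power_sum a N s).
have cF : continuous F.
  by move=> s; exact/differentiable_continuous/derivable1_diffP.
rewrite (@continuous_FTC2 _ _ F) //.
- rewrite [X in (_ - X%:E)%E](_ : _ = 0) ?sube0 // /F big1 // => k _.
  by rewrite expr0n mulr0.
- exact/continuous_subspaceT/continuous_power_sum.
- split => //; first exact/cvg_at_right_filter/cF.
  exact/cvg_at_left_filter/cF.
- move=> s _; rewrite derive1E.
  by case: (is_derive_power_sum a N s).
Qed.

(** Monotone convergence: the integral of the series is the limit of the integrals of its partial
    sums, each at most M. The open interval leaves out s = u, where the series may diverge. *)
Lemma integrable_nneg_power_series (c : nat -> R) (u M : R) :
  0 <= u -> (forall k, 0 <= c k) ->
  (forall N, \sum_(k < N) c k / k.+1%:R * u ^+ k.+1 <= M) ->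
  mu.-integrable `]0%R, u[ (fun s => \sum_(0 <= k <oo) (c k * s ^+ k)%:E)%E.
Proof.
move=> u0 c0 cM.
have mc k : measurable_fun `]0, u[ (fun s : R => (c k * s ^+ k)%:E).
  apply/measurable_EFinP; apply: measurable_funM; first exact: measurable_cst.
  exact: exprn_measurable.
have ge0 k (s : R) : `]0, u[ s -> (0 <= (c k * s ^+ k)%:E)%E.
  rewrite /= in_itv /= => /andP[s0 _].
  by rewrite lee_fin mulr_ge0 // exprn_ge0 // ltW.
apply/integrableP; split.
  apply: (@ge0_emeasurable_sum _ _ _ _ _ predT) => [k s sD _|k _]; first exact: ge0.
  exact: mc.
under eq_integral.
  move=> s; rewrite inE => s0u; rewrite gee0_abs; last first.
    by apply: nneseries_ge0 => k _ _; exact: ge0.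
  over.
rewrite integral_nneseries //.
apply: (@le_lt_trans _ _ M%:E); last exact: ltry.
apply: lime_le.
  by apply: is_cvg_nneseries => k _ _; apply: integral_ge0 => s; exact: ge0.
apply: nearW => N; rewrite big_mkord.
rewrite -ge0_integral_sum //; [|by move=> k; exact: mc|by move=> k s; exact: ge0].
under eq_integral do rewrite sumEFin.
rewrite -(integral_itv_bndoo true false); last first.
  by apply/measurable_EFinP; exact: measurable_power_sum.
by rewrite integral_power_sum // lee_fin.
Qed.

(** Dominated convergence, with the full series of [c] as majorant. Bounds and limits are required
    only on the open interval, so [h] may be singular at the endpoints, which have measure zero. *)
Lemma cvg_integral_power_sum (a c : nat -> R) (h : R -> R) (u M : R) :
  0 <= u -> (forall k, 0 <= c k) ->
  (forall N, \sum_(k < N) c k / k.+1%:R * u ^+ k.+1 <= M) ->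
  (forall N (s : R), 0 < s < u ->
     `|\sum_(k < N) a k * s ^+ k| <= \sum_(k < N) c k * s ^+ k) ->
  (forall s : R, 0 < s < u -> \sum_(k < N) a k * s ^+ k @[N --> \oo] --> h s) ->
  \sum_(k < N) a k / k.+1%:R * u ^+ k.+1 @[N --> \oo]
    --> Rintegral mu `[0, u] h.
Proof.
move=> u0 c0 cM ac ah.
have mp N : measurable_fun `]0, u[ (fun s => \sum_(k < N) a k * s ^+ k).
  exact: measurable_power_sum.
have mh : measurable_fun `]0, u[ h.
  apply: (measurable_fun_cvg mp) => s; rewrite /= in_itv /=; exact: ah.
pose g (s : R) : \bar R := (\sum_(0 <= k <oo) (c k * s ^+ k)%:E)%E.
have [] := @dominated_convergence _ _ R mu `]0, u[ (measurable_itv _)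
    (fun N s => (\sum_(k < N) a k * s ^+ k)%:E) (EFin \o h) g.
- by move=> N; apply/measurable_EFinP; exact: mp.
- by apply/measurable_EFinP.
- apply: aeW => s; rewrite /= in_itv /= => su.
  by apply/fine_cvgP; split; [exact: nearW|exact: ah].
- exact: integrable_nneg_power_series cM.
- apply: aeW => s N; rewrite /= in_itv /= => su.
  apply: (@le_trans _ _ (\sum_(k < N) c k * s ^+ k)%:E).
    by rewrite lee_fin; exact: ac.
  rewrite -sumEFin /g.
  rewrite -(big_mkord xpredT (fun k => (c k * s ^+ k)%:E)).
  apply: nneseries_lim_ge => k _ _.
  by rewrite lee_fin mulr_ge0 // exprn_ge0 // ltW; case/andP: su.
move=> ih _ lh.
rewrite /Rintegral.
under eq_integral do rewrite -[(h _)%:E]/((EFin \o h) _).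
rewrite integral_itv_bndoo; last by apply/measurable_EFinP.
have fI : (\int[mu]_(s in `]0%R, u[) (EFin \o h) s)%E \is a fin_num.
  exact: integrable_fin_num.
move: lh; rewrite -(fineK fI) => /fine_cvg lh.
apply: cvg_trans lh; apply: near_eq_cvg; apply: nearW => N.
rewrite /= -(integral_itv_bndoo true false) ?integral_power_sum //.
by apply/measurable_EFinP; exact: mp.
Qed.
End PowerSumIntegral.

(** * Complex sequences *)

Section ComplexLimits.
Local Open Scope classical_set_scope.
Local Open Scope complex_scope.
Variable R : realType.
Local Notation C := R[i].
Local Notation normc := (@Normc.normc R).
Implicit Types (x y z t l : C) (u s : R).

Lemma ReD x y : complex.Re (x + y) = complex.Re x + complex.Re y.
Proof. by case: x y => [? ?] [? ?]. Qed.

Lemma ImD x y : complex.Im (x + y) = complex.Im x + complex.Im y.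
Proof. by case: x y => [? ?] [? ?]. Qed.

Lemma ReM x y :
  complex.Re (x * y) = complex.Re x * complex.Re y - complex.Im x * complex.Im y.
Proof. by case: x y => [? ?] [? ?]. Qed.

Lemma ImM x y :
  complex.Im (x * y) = complex.Re x * complex.Im y + complex.Im x * complex.Re y.
Proof. by case: x y => [? ?] [? ?]. Qed.

Lemma ReMr z u : complex.Re (z * u%:C) = complex.Re z * u.
Proof. by rewrite ReM /= mulr0 subr0. Qed.

Lemma ImMr z u : complex.Im (z * u%:C) = complex.Im z * u.
Proof. by rewrite ImM /= mulr0 add0r. Qed.

Lemma Re_sum N (F : 'I_N -> C) :
  complex.Re (\sum_(k < N) F k) = \sum_(k < N) complex.Re (F k).
Proof. exact: (big_morph _ ReD). Qed.

Lemma Im_sum N (F : 'I_N -> C) :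
  complex.Im (\sum_(k < N) F k) = \sum_(k < N) complex.Im (F k).
Proof. exact: (big_morph _ ImD). Qed.

Lemma normc_norm x : `|x| = (normc x)%:C.
Proof. by []. Qed.

Lemma normc_ge0 x : 0 <= normc x.
Proof. by rewrite -lecR -normc_norm normr_ge0. Qed.

Lemma normc_ler_sum N (F : 'I_N -> C) (G : 'I_N -> R) :
  (forall k, normc (F k) <= G k) ->
  normc (\sum_(k < N) F k) <= \sum_(k < N) G k.
Proof.
move=> FG; elim/big_ind2: _ => [|x y z t xy zt|//]; first by rewrite Normc.normc0.
by apply: (le_trans (le_normcD _ _)); exact: lerD.
Qed.

Lemma normcX x n : normc (x ^+ n) = normc x ^+ n.
Proof.
elim: n => [|n IH]; first by rewrite !expr0 Normc.normc1.
by rewrite !exprS Normc.normcM IH.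
Qed.

Lemma normc_real u : 0 <= u -> normc u%:C = u.
Proof. by move=> u0; rewrite /= expr0n /= addr0 sqrtr_sqr ger0_norm. Qed.

Lemma le_Re_normc x : `|complex.Re x| <= normc x.
Proof. by rewrite -lecR -normc_norm; exact: normc_ge_Re. Qed.

Lemma le_Im_normc x : `|complex.Im x| <= normc x.
Proof.
case: x => a b; rewrite /= -sqrtr_sqr ler_sqrt ?addr_ge0 ?sqr_ge0 //.
by rewrite lerDr sqr_ge0.
Qed.

(** Componentwise, because [cintegral] and [Li] are themselves assembled from real and imaginary
    parts. *)
Definition ccvg (f_ : nat -> C) l :=
  (complex.Re (f_ N) @[N --> \oo] --> complex.Re l) /\
  (complex.Im (f_ N) @[N --> \oo] --> complex.Im l).

Lemma ccvg_cst l : ccvg (fun=> l) l.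
Proof. by split; exact: cvg_cst. Qed.

Lemma ccvgD f_ g_ l t :
  ccvg f_ l -> ccvg g_ t -> ccvg (fun N => f_ N + g_ N) (l + t).
Proof.
move=> [ul1 ul2] [vt1 vt2]; split.
  by rewrite ReD; under eq_fun do rewrite ReD; exact: cvgD.
by rewrite ImD; under eq_fun do rewrite ImD; exact: cvgD.
Qed.

Lemma ccvgMl z f_ l : ccvg f_ l -> ccvg (fun N => z * f_ N) (z * l).
Proof.
move=> [ul1 ul2]; split.
  rewrite ReM; under eq_fun do rewrite ReM.
  by apply: cvgB; apply: cvgM => //; exact: cvg_cst.
rewrite ImM; under eq_fun do rewrite ImM.
by apply: cvgD; apply: cvgM => //; exact: cvg_cst.
Qed.

Lemma ccvgB f_ g_ l t :
  ccvg f_ l -> ccvg g_ t -> ccvg (fun N => f_ N - g_ N) (l - t).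
Proof.
move=> ul /(ccvgMl (-1)) vt; rewrite -mulN1r.
by under eq_fun do rewrite -mulN1r; exact: ccvgD.
Qed.

Lemma ccvg_sum n (f_ : nat -> nat -> C) (l : nat -> C) :
  (forall k, (k < n)%N -> ccvg (f_ k) (l k)) ->
  ccvg (fun N => \sum_(k < n) f_ k N) (\sum_(k < n) l k).
Proof.
elim: n => [|n IH] ul.
  by rewrite big_ord0; under eq_fun do rewrite big_ord0; exact: ccvg_cst.
rewrite big_ord_recr; under eq_fun do rewrite big_ord_recr.
by apply: ccvgD; [apply: IH => k /ltnW; exact: ul|exact: ul].
Qed.

Lemma ccvg_shiftS f_ l : ccvg (fun N => f_ N.+1) l <-> ccvg f_ l.
Proof.
by split=> -[ul1 ul2]; split;
  [rewrite -cvg_shiftS|rewrite -cvg_shiftS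
  |rewrite -cvg_shiftS in ul1|rewrite -cvg_shiftS in ul2].
Qed.

Lemma near_ccvg f_ g_ l :
  (\forall N \near \oo, f_ N = g_ N) -> ccvg f_ l -> ccvg g_ l.
Proof.
move=> uv [ul1 ul2]; split.
  by apply: cvg_trans ul1; apply: near_eq_cvg; apply: filterS uv => N ->.
by apply: cvg_trans ul2; apply: near_eq_cvg; apply: filterS uv => N ->.
Qed.

Lemma ccvg0_le f_ (g_ : nat -> R) :
  (forall N, normc (f_ N) <= g_ N) -> g_ N @[N --> \oo] --> 0 -> ccvg f_ 0.
Proof.
move=> uv v0.
have nv0 : - g_ N @[N --> \oo] --> (0 : R) by rewrite -oppr0; exact: cvgN.
split; apply: squeeze_cvgr nv0 v0; apply: nearW => N; rewrite -ler_norml.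
  exact: le_trans (le_Re_normc _) (uv N).
exact: le_trans (le_Im_normc _) (uv N).
Qed.

Lemma ccvg_unique f_ l t : ccvg f_ l -> ccvg f_ t -> l = t.
Proof.
move=> [ul1 ul2] [ut1 ut2]; apply/eqP; rewrite eq_complex.
by rewrite (cvg_unique _ ul1 ut1) // (cvg_unique _ ul2 ut2) // !eqxx.
Qed.

(** The real statement applied to both components; one majorant serves both, as |Re z| and |Im z|
    are at most |z|. *)
Lemma cvg_cintegral_power_sum (a : nat -> C) (c : nat -> R) (h : R -> C)
    (u M : R) :
  0 <= u -> (forall k, 0 <= c k) ->
  (forall N, \sum_(k < N) c k / k.+1%:R * u ^+ k.+1 <= M) ->
  (forall N s, 0 < s < u ->
     normc (\sum_(k < N) a k * s%:C ^+ k) <= \sum_(k < N) c k * s ^+ k) ->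
  (forall s, 0 < s < u -> ccvg (fun N => \sum_(k < N) a k * s%:C ^+ k) (h s)) ->
  ccvg (fun N => \sum_(k < N) a k / k.+1%:R * u%:C ^+ k.+1) (cintegral h u).
Proof.
move=> u0 c0 cM ac ah.
have ReE N s : complex.Re (\sum_(k < N) a k * s%:C ^+ k) =
    \sum_(k < N) complex.Re (a k) * s ^+ k.
  by rewrite Re_sum; apply: eq_bigr => k _; rewrite -rmorphXn ReMr.
have ImE N s : complex.Im (\sum_(k < N) a k * s%:C ^+ k) =
    \sum_(k < N) complex.Im (a k) * s ^+ k.
  by rewrite Im_sum; apply: eq_bigr => k _; rewrite -rmorphXn ImMr.
have nE k : (k.+1%:R : C)^-1 * u%:C ^+ k.+1 = (k.+1%:R^-1 * u ^+ k.+1)%:C.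
  by rewrite rmorphM fmorphV rmorphXn /= rmorph_nat.
have cE : cintegral h u =
    (Rintegral lebesgue_measure `[0, u] (fun s => complex.Re (h s)))
    +i* (Rintegral lebesgue_measure `[0, u] (fun s => complex.Im (h s))).
  by rewrite [RHS]complexE.
rewrite cE; split => /=.
- rewrite (_ : (fun N => _) = fun N : nat =>
      \sum_(k < N) complex.Re (a k) / k.+1%:R * u ^+ k.+1); last first.
    apply/funext => N; rewrite Re_sum; apply: eq_bigr => k _.
    by rewrite -mulrA nE ReMr mulrA.
  apply: (@cvg_integral_power_sum _ (fun k => complex.Re (a k)) c _ u M) => //
    [N s su|s su].
    by rewrite -ReE (le_trans (le_Re_normc _)) // ac.
  by under eq_fun do rewrite -ReE; exact: (ah s su).1.
- rewrite (_ : (fun N => _) = fun N : nat =>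
      \sum_(k < N) complex.Im (a k) / k.+1%:R * u ^+ k.+1); last first.
    apply/funext => N; rewrite Im_sum; apply: eq_bigr => k _.
    by rewrite -mulrA nE ImMr mulrA.
  apply: (@cvg_integral_power_sum _ (fun k => complex.Im (a k)) c _ u M) => //
    [N s su|s su].
    by rewrite -ImE (le_trans (le_Im_normc _)) // ac.
  by under eq_fun do rewrite -ImE; exact: (ah s su).2.
Qed.
End ComplexLimits.

(** * Coefficient sequences *)

Section Coefficients.
Local Open Scope classical_set_scope.
Variable R : realType.
Implicit Types (c : nat -> R).

(** The invariant carried through the iterated integration. With no constant term, the third
    condition bounds the integral of the series against dt/t up to the endpoint 1. *)
Definition admissible c :=
  [/\ c 0%N = 0, forall k, 0 <= c k <= 1
    & forall N, \sum_(k < N) c k / k%:R <= 1].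

Definition div_coef c k : R := c k / k%:R.
Definition avg_coef c k : R := (\sum_(j < k) c j) / k%:R.

Lemma admissible_ge0 c : admissible c -> forall k, 0 <= c k.
Proof. by case=> _ c01 _ k; case/andP: (c01 k). Qed.

Lemma admissible_sum_le c : admissible c -> forall N, \sum_(k < N) c k <= N%:R.
Proof.
case=> _ c01 _ N; rewrite -[N in N%:R]card_ord -sum1_card natr_sum.
by apply: ler_sum => k _; case/andP: (c01 k).
Qed.

Lemma ler_invn1 k (y : R) : 0 <= y -> y / k%:R <= y.
Proof.
case: k => [|k] y0; first by rewrite invr0 mulr0.
by rewrite ler_pdivrMr // ler_peMr // ler1n.
Qed.

Lemma admissible_div c : admissible c -> admissible (div_coef c).
Proof.
move=> ac; have c0 := admissible_ge0 ac; case: ac => c00 c01 cs.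
split; first by rewrite /div_coef c00 mul0r.
  move=> k; rewrite divr_ge0 //= (le_trans (ler_invn1 k (c0 k))) //.
  by case/andP: (c01 k).
move=> N; apply: le_trans (cs N); apply: ler_sum => k _.
by rewrite ler_invn1 // divr_ge0.
Qed.

(* The tail bound [sum_(k > j) 1/k^2 <= 1/j] makes the averaging step
   contract the weighted sum; the second summand keeps track of it. *)
Lemma avg_weighted_sum_le c N : (forall k, 0 <= c k) -> c 0%N = 0 ->
  \sum_(k < N.+2) avg_coef c k / k%:R + (\sum_(j < N.+2) c j) / N.+1%:R
    <= \sum_(k < N.+2) c k / k%:R.
Proof.
move=> c0 c00; elim: N => [|N IH].
  rewrite !big_ord_recr !big_ord0 /= /avg_coef !big_ord_recr !big_ord0 /= c00.
  by rewrite !(mul0r, add0r, addr0, divr1).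
rewrite big_ord_recr [X in _ <= X]big_ord_recr /=.
rewrite [X in _ + X / _]big_ord_recr /= mulrDl addrA lerD2r.
apply: le_trans IH; rewrite -addrA lerD2l /avg_coef.
set S := \sum_(j < _) _.
have S0 : 0 <= S by apply: sumr_ge0.
rewrite -mulrA -mulrDr ler_wpM2l //.
rewrite -[N.+2%:R]natr1.
have n0 : 0 < N.+1%:R :> R by rewrite ltr0n.
set m := N.+1%:R in n0 *.
have m0 : 0 < m + 1 by rewrite addr_gt0.
(* With m = N + 1 the claim is now 1/(m+1)^2 + 1/(m+1) <= 1/m, that is, m (m+2) <= (m+1)^2. *)
have -> : (m + 1)^-1 / (m + 1) + (m + 1)^-1 = (m + 2) / (m + 1) ^+ 2.
  by field; rewrite lt0r_neq0.
rewrite ler_pdivrMr ?exprn_gt0 // mulrC ler_pdivlMr //.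
rewrite expr2; nra.
Qed.

Lemma admissible_avg c : admissible c -> admissible (avg_coef c).
Proof.
move=> ac; have c0 := admissible_ge0 ac; have cN := admissible_sum_le ac.
case: ac => c00 c01 cs.
split; first by rewrite /avg_coef big_ord0 mul0r.
  move=> k; rewrite divr_ge0 ?sumr_ge0 //=.
  rewrite /avg_coef; case: k => [|k]; first by rewrite big_ord0 mul0r.
  by rewrite ler_pdivrMr // mul1r.
(* [avg_weighted_sum_le] speaks of at least two terms; the shorter sums vanish, using 1/0 = 0. *)
case=> [|[|N]]; first by rewrite big_ord0.
  by rewrite big_ord1 /= invr0 mulr0.
apply: le_trans (cs N.+2); apply: le_trans (avg_weighted_sum_le N c0 c00).
by rewrite lerDl divr_ge0 // sumr_ge0.
Qed.

Lemma sum_delta (V : pzSemiRingType) (F : nat -> V) m N :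
  \sum_(k < N) (nat_of_ord k == m)%:R * F k = (m < N)%:R * F m.
Proof.
elim: N => [|N IH]; first by rewrite big_ord0 mul0r.
rewrite big_ord_recr /= IH ltnS (leq_eqVlt m N) (eq_sym m N).
have [->|Nm] := eqVneq N m; first by rewrite ltnn mul0r add0r.
by rewrite mul0r addr0.
Qed.

(** These are the coefficients of t^n / n, the innermost integral of t^(n-1) dt. *)
Lemma admissible_delta n : (0 < n)%N ->
  admissible (fun k => (k == n)%:R / n%:R).
Proof.
move=> n0; have n1 : (n%:R : R)^-1 <= 1 by rewrite invf_le1 ?ltr0n // ler1n.
have ni0 : 0 <= (n%:R : R)^-1 by rewrite invr_ge0.
split; first by rewrite eq_sym (gtn_eqF n0) mul0r.
  by move=> k; case: eqP => _ /=; rewrite ?mul1r ?mul0r ?ni0 ?n1 ?lexx ?ler01.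
move=> N; under eq_bigr do rewrite -mulrA.
rewrite (sum_delta (fun k => n%:R^-1 * k%:R^-1)).
by case: ltnP => _; rewrite ?mul0r // mul1r mulr_ile1.
Qed.

(** With r the square root of s, N s^N = (N r^N) r^N, and N r^N <= sum_(k < N) r^k <= 1/(1 - r). *)
Lemma cvg_natM_geometric (s : R) : 0 <= s < 1 ->
  N%:R * s ^+ N @[N --> \oo] --> (0 : R).
Proof.
case/andP=> s0 s1; pose r := Num.sqrt s.
have r0 : 0 <= r := sqrtr_ge0 s.
have r1 : r < 1 by rewrite /r -sqrtr1 ltr_sqrt.
have sE : s = r ^+ 2 by rewrite sqr_sqrtr.
have r1' : 0 < 1 - r by rewrite subr_gt0.
apply: (@squeeze_cvgr _ _ _ _ (fun=> 0) (fun N => (1 - r)^-1 * r ^+ N)).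
- apply: nearW => N; rewrite mulr_ge0 ?exprn_ge0 //=.
  rewrite sE -exprM mulnC exprM expr2 mulrA ler_wpM2r ?exprn_ge0 //.
  rewrite -[leRHS]mulr1 ler_pdivlMl //.
  have -> : N%:R * r ^+ N = \sum_(k < N) r ^+ N.
    by rewrite sumr_const card_ord mulr_natl.
  apply: (@le_trans _ _ ((1 - r) * \sum_(k < N) r ^+ k)).
    rewrite ler_pM2l //; apply: ler_sum => k _.
    by apply: ler_wiXn2l => //; [exact: ltW|exact: ltnW].
  by rewrite -opprB mulNr -subrX1 opprB gerBl exprn_ge0.
- exact: cvg_cst.
- rewrite -(mulr0 (1 - r)^-1); apply: cvgM; first exact: cvg_cst.
  by apply: cvg_expr; rewrite ger0_norm.
Qed.
End Coefficients.

(** * Integration against one form *)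

Section IntegrationSteps.
Local Open Scope classical_set_scope.
Local Open Scope complex_scope.
Variable R : realType.
Local Notation C := R[i].
Local Notation normc := (@Normc.normc R).
Implicit Types (x y z t l : C) (u s : R) (c : nat -> R).

Definition psum c t N : C := \sum_(k < N) (c k)%:C * t ^+ k.

Lemma psumS c t N : c 0%N = 0 ->
  psum c t N.+1 = \sum_(k < N) (c k.+1)%:C * t ^+ k.+1.
Proof. by move=> c0; rewrite /psum big_ord_recl c0 mul0r add0r. Qed.

Lemma ccvg_psum_div c x u (G : R -> C) :
  normc x <= 1 -> 0 <= u <= 1 -> admissible c ->
  (forall s, 0 < s < u -> ccvg (psum c (x * s%:C)) (G s)) ->
  ccvg (psum (div_coef c) (x * u%:C))
       (cintegral (fun s => x * form_t (x * s%:C) * G s) u).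
Proof.
move=> x1 /andP[u0 u1] ac cG.
have c0 := admissible_ge0 ac; have [c00 _ cs] := ac.
(* Since c 0 = 0, N + 1 terms of [psum] are N terms of the shape a_k / (k+1) u^(k+1) produced by
   termwise integration. *)
apply/ccvg_shiftS.
rewrite (_ : (fun N => _) = fun N : nat =>
    \sum_(k < N) (c k.+1)%:C * x ^+ k.+1 / k.+1%:R * u%:C ^+ k.+1); last first.
  apply/funext => N; rewrite psumS ?/div_coef ?c00 ?mul0r //.
  apply: eq_bigr => k _; rewrite rmorphM fmorphV /= rmorph_nat exprMn.
  by rewrite !mulrA; congr (_ * _); rewrite mulrAC.
apply: (@cvg_cintegral_power_sum _ (fun k => (c k.+1)%:C * x ^+ k.+1)
          (fun k => c k.+1) _ u 1) => //.
- move=> N; apply: le_trans (cs N.+1).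
  rewrite [leRHS]big_ord_recl c00 mul0r add0r; apply: ler_sum => k _ /=.
  by rewrite ler_piMr ?divr_ge0 // exprn_ile1.
- move=> N s /andP[s0 _]; apply: normc_ler_sum => k.
  rewrite !Normc.normcM normc_real // !normcX normc_real ?(ltW s0) //.
     rewrite ler_wpM2r ?exprn_ge0 ?(ltW s0) // ler_piMr //.
  by rewrite exprn_ile1 // normc_ge0.
- move=> s su; have /andP[s0 _] := su.
  have /(ccvgMl (x * form_t (x * s%:C))) := iffRL (ccvg_shiftS _ _) (cG s su).
  apply: near_ccvg; apply: nearW => N; rewrite psumS // mulr_sumr; apply: eq_bigr => k _.
  (* For x = 0 both sides vanish, whatever value [form_t] takes at 0; otherwise x / (x s) = 1 / s
     lowers the power of s by one. *)
  have [->|x0] := eqVneq x 0; first by rewrite !exprS !(mul0r, mulr0).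
  have s0' : s%:C != 0 by rewrite fmorph_eq0 lt0r_neq0.
  rewrite /form_t; move: (s%:C) (c k.+1)%:C s0' => v e v0.
  by rewrite exprMn [v ^+ k.+1]exprS; field; rewrite x0 v0.
Qed.

Lemma one_minus_mul_sum (S : comPzRingType) (c : nat -> S) (t : S) N :
  (1 - t) * (\sum_(k < N) (\sum_(j < k.+1) c j) * t ^+ k) =
  \sum_(k < N) c k * t ^+ k - (\sum_(k < N) c k) * t ^+ N.
Proof.
elim: N => [|N IH]; first by rewrite !big_ord0 mulr0 mul0r subrr.
rewrite !big_ord_recr /= mulrDr IH exprS; ring.
Qed.

Lemma real_complex_sum N (F : 'I_N -> R) :
  (\sum_(k < N) F k)%:C = \sum_(k < N) (F k)%:C.
Proof. exact: rmorph_sum. Qed.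

(** A termwise majorant would fail at u = 1, where the sum of S_(k+1) / (k+1) may diverge. Abel
    summation instead bounds each partial sum as a whole by (2 / d) sum_(k < N) c_k s^k. *)
Lemma ccvg_psum_avg c x u (d : R) (G : R -> C) :
  normc x <= 1 -> 0 <= u <= 1 -> admissible c ->
  0 < d -> (forall s, 0 < s < u -> d <= normc (1 - x * s%:C)) ->
  (forall s, 0 < s < u -> ccvg (psum c (x * s%:C)) (G s)) ->
  ccvg (psum (avg_coef c) (x * u%:C))
       (cintegral (fun s => x * form_one_minus (x * s%:C) * G s) u).
Proof.
move=> x1 /andP[u0 u1] ac d0 dx cG.
have c0 := admissible_ge0 ac; have cN := admissible_sum_le ac.
have [c00 _ cs] := ac.
have di0 : 0 <= d^-1 by rewrite invr_ge0 ltW.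
pose S k : R := \sum_(j < k) c j.
have S0 k : 0 <= S k by apply: sumr_ge0.
pose a k : C := (S k.+1)%:C * x ^+ k.+1.
apply/ccvg_shiftS.
rewrite (_ : (fun N => _) = fun N : nat =>
    \sum_(k < N) a k / k.+1%:R * u%:C ^+ k.+1); last first.
  apply/funext => N; rewrite psumS ?/avg_coef ?big_ord0 ?mul0r //.
  apply: eq_bigr => k _; rewrite rmorphM fmorphV /= rmorph_nat exprMn.
  by rewrite !mulrA; congr (_ * _); rewrite mulrAC.
have aE N s : 0 < s < u -> \sum_(k < N) a k * s%:C ^+ k =
    x * form_one_minus (x * s%:C) *
      (psum c (x * s%:C) N - (S N)%:C * (x * s%:C) ^+ N).
  move=> su; have := dx s su; set t := x * s%:C => dt.
  have t1 : 1 - t != 0.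
    by apply: contraTneq dt => ->; rewrite Normc.normc0 -ltNge.
  have := one_minus_mul_sum (fun k => (c k)%:C) t N.
  rewrite -/(psum c t N) -(real_complex_sum (fun k : 'I_N => c k)) => <-.
  rewrite /form_one_minus -mulrA mulKf // mulr_sumr; apply: eq_bigr => k _.
  by rewrite -real_complex_sum /a /t exprMn exprS; ring.
have psum_le N s : 0 < s < u ->
    normc (psum c (x * s%:C) N) <= \sum_(k < N) c k * s ^+ k.
  case/andP=> s0 _; apply: normc_ler_sum => k.
  rewrite Normc.normcM normc_real // normcX Normc.normcM normc_real ?(ltW s0) //.
  rewrite ler_wpM2l // exprMn ler_piMl ?exprn_ge0 ?(ltW s0) // exprn_ile1 //.
  exact: normc_ge0.
have S_le N s : 0 < s < u ->
    normc ((S N)%:C * (x * s%:C) ^+ N) <= S N * s ^+ N.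
  case/andP=> s0 _.
  rewrite Normc.normcM normc_real // normcX Normc.normcM normc_real ?(ltW s0) //.
  rewrite ler_wpM2l // exprMn ler_piMl ?exprn_ge0 ?(ltW s0) // exprn_ile1 //.
  exact: normc_ge0.
(* The factor 2 counts the partial sum and the boundary term S_N t^N; 1/d bounds the form. *)
apply: (@cvg_cintegral_power_sum _ a (fun k => d^-1 * 2 * c k) _ u (d^-1 * 2)) => //.
- by move=> k; rewrite !mulr_ge0.
- move=> N; under eq_bigr do rewrite -!mulrA.
  rewrite -!mulr_sumr mulrA ler_piMr ?mulr_ge0 //.
  apply: le_trans (cs N); apply: ler_sum => k _.
  (* At k = 0 the bound 1/(k+1) <= 1/k fails, as 1/0 is 0 here; c 0 = 0 covers it. *)
  have [->|k0] := posnP k; first by rewrite c00 !mul0r.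
  rewrite ler_wpM2l //.
  apply: (@le_trans _ _ k.+1%:R^-1); first by rewrite ler_piMr ?exprn_ile1 // invr_ge0.
  by rewrite lef_pV2 ?posrE ?ltr0n // ler_nat.
- move=> N s su; have /andP[s0 su'] := su.
  rewrite aE // !Normc.normcM /form_one_minus Normc.normcV.
  have s1 : s <= 1 by rewrite (le_trans _ u1) // ltW.
  have -> : \sum_(k < N) d^-1 * 2 * c k * s ^+ k =
      d^-1 * 2 * \sum_(k < N) c k * s ^+ k.
    by rewrite mulr_sumr; apply: eq_bigr => k _; rewrite mulrA.
  have i_le : (normc (1 - x * s%:C))^-1 <= d^-1.
    by rewrite lef_pV2 ?posrE ?dx // (lt_le_trans d0) // dx.
  have n_le : normc (psum c (x * s%:C) N - (S N)%:C * (x * s%:C) ^+ N) <=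
      2 * \sum_(k < N) c k * s ^+ k.
    apply: (le_trans (le_normcD _ _)); rewrite normcN mulrDl mul1r.
    apply: lerD; first exact: psum_le.
    apply: (le_trans (S_le N s su)); rewrite /S mulr_suml; apply: ler_sum => k _.
    by rewrite ler_wpM2l //; apply: ler_wiXn2l => //; [exact: ltW|exact: ltnW].
  have ii : 0 <= (normc (1 - x * s%:C))^-1 by rewrite invr_ge0 normc_ge0.
  apply: (@le_trans _ _ (1 * d^-1 * (2 * \sum_(k < N) c k * s ^+ k))).
    by apply: ler_pM => //; rewrite ?mulr_ge0 ?normc_ge0 // ler_pM ?normc_ge0.
  by rewrite mul1r mulrA.
- move=> s su; have /andP[s0 su'] := su.
  (* The boundary term disappears in the limit: S_N <= N and N s^N tends to 0 for s < 1. *)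
  have S_cvg0 : ccvg (fun N => (S N)%:C * (x * s%:C) ^+ N) 0.
    apply: (@ccvg0_le _ _ (fun N => N%:R * s ^+ N)) => [N|].
      rewrite (le_trans (S_le N s su)) // ler_wpM2r ?exprn_ge0 ?(ltW s0) //.
      exact: cN.
    by apply: cvg_natM_geometric; rewrite ltW //= (lt_le_trans su').
  have := ccvgMl (x * form_one_minus (x * s%:C)) (ccvgB (cG s su) S_cvg0).
  rewrite subr0; apply: near_ccvg; apply: nearW => N; exact/esym/aE.
Qed.
End IntegrationSteps.

(** * Nested integrals as power series *)

Section NestedIntegrals.
Local Open Scope classical_set_scope.
Local Open Scope complex_scope.
Variable R : realType.
Local Notation C := R[i].
Local Notation normc := (@Normc.normc R).
Implicit Types (x y z t l : C) (u s : R) (c : nat -> R).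

(* A word lists the forms dt/(1-t) ([true]) and dt/t ([false]) from the
   outermost integral inwards; the innermost form t^(n-1) dt is left implicit. *)
Definition letter_form (b : bool) : C -> C :=
  if b then form_one_minus else form_t.
Definition letter_op (b : bool) c : nat -> R :=
  if b then avg_coef c else div_coef c.
Definition word_coef (n : nat) (ops : seq bool) : nat -> R :=
  foldr letter_op (fun k => (k == n)%:R / n%:R) ops.

Lemma admissible_word_coef n ops : (0 < n)%N -> admissible (word_coef n ops).
Proof.
move=> n0; elim: ops => [|[] ops IH] /=; first exact: admissible_delta.
  exact: admissible_avg.
exact: admissible_div.
Qed.

(** Re (1 - x s) = 1 - s Re x is affine in s, hence at least the smaller of its end values 1 and 1 -
    u Re x. The latter is positive: u Re x = 1 would force u = 1, Re x = 1 and, by |x| <= 1, x =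
    1. *)
Lemma one_minus_bounded_below x u : normc x <= 1 -> 0 <= u <= 1 ->
  (u = 1 -> x <> 1) ->
  exists2 d : R, 0 < d & forall s, 0 < s < u -> d <= normc (1 - x * s%:C).
Proof.
move=> x1 /andP[u0 u1] ux; pose r := complex.Re x.
have r1 : r <= 1 by rewrite (le_trans (ler_norm _)) // (le_trans (le_Re_normc _)).
have ur1 : u * r < 1.
  have [ult1|] := ltP u 1.
    have [r0|r0] := leP 0 r; last by nra.
    by nra.
  move=> u1'; have uE : u = 1 by apply/eqP; rewrite eq_le u1.
  rewrite uE mul1r lt_neqAle r1 andbT; apply/eqP => rE; apply: (ux uE).
  move: x1 rE; rewrite /r; case: x {ux r r1} => a b /= ab1 aE.
  move: ab1; rewrite aE -[leRHS]sqrtr1 ler_sqrt //.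
  rewrite expr1n gerDl => b0.
  have /eqP : b ^+ 2 = 0 by apply/eqP; rewrite eq_le b0 sqr_ge0.
  by rewrite sqrf_eq0 => /eqP ->.
exists (Num.min 1 (1 - u * r)); first by rewrite lt_min ltr01 subr_gt0.
move=> s /andP[s0 su]; apply: le_trans (le_Re_normc _).
apply: le_trans (ler_norm _).
have -> : complex.Re (1 - x * s%:C) = 1 - s * r.
  by rewrite /r; case: (x) => a b /=; rewrite mulr0 subr0 mulrC.
rewrite ge_min; have [r0|r0] := leP r 0; apply/orP; [left|right]; nra.
Qed.

Lemma ccvg_delta (F : nat -> C) m :
  ccvg (fun N => \sum_(k < N) (nat_of_ord k == m)%:R * F k) (F m).
Proof.
apply: near_ccvg (ccvg_cst (F m)).
near=> N; rewrite sum_delta.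
have -> : (m < N)%N by near: N; exact: nbhs_infty_gt.
by rewrite mul1r.
Unshelve. all: end_near. Qed.

Lemma ccvg_nested_form_pow x n u : normc x <= 1 -> (0 < n)%N -> 0 <= u <= 1 ->
  ccvg (psum (fun k => (k == n)%:R / n%:R) (x * u%:C))
       (nested_int x [:: form_pow n] u).
Proof.
case: n => // n x1 _ /andP[u0 u1].
apply/ccvg_shiftS.
rewrite (_ : (fun N => _) = fun N : nat =>
    \sum_(k < N) (k == n :> nat)%:R * x ^+ n.+1 / k.+1%:R * u%:C ^+ k.+1); last first.
  apply/funext => N; rewrite psumS ?mul0r //; apply: eq_bigr => k _.
  rewrite eqSS; case: eqP => [->|_]; last by rewrite !mul0r.
  by rewrite !mul1r fmorphV /= rmorph_nat exprMn mulrA [_ * x ^+ _]mulrC.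
apply: (@cvg_cintegral_power_sum _ (fun k => (k == n)%:R * x ^+ n.+1)
  (fun k => (k == n)%:R) _ u 1) => //.
- move=> N; under eq_bigr do rewrite -mulrA.
  rewrite (sum_delta (fun k => k.+1%:R^-1 * u ^+ k.+1)).
  case: ltnP => _; rewrite ?mul0r // mul1r mulr_ile1 ?exprn_ge0 ?invr_ge0 //.
    by rewrite invf_le1 ?ltr0n // ler1n.
  exact: exprn_ile1.
- move=> N s /andP[s0 _]; apply: normc_ler_sum => k.
  case: eqP => _; last by rewrite !mul0r Normc.normc0.
  rewrite !mul1r Normc.normcM !normcX normc_real ?(ltW s0) //.
  by rewrite ler_piMl ?exprn_ge0 ?(ltW s0) // exprn_ile1 // normc_ge0.
- move=> s _ /=.
  have -> : x * form_pow n.+1 (x * s%:C) * 1 = x ^+ n.+1 * s%:C ^+ n.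
    by rewrite mulr1 /form_pow /= exprMn mulrA -exprS.
  apply: near_ccvg (ccvg_delta (fun k => x ^+ n.+1 * s%:C ^+ k) n).
  by apply: nearW => N; apply: eq_bigr => k _; rewrite mulrA.
Qed.

(** Induction on the word. The condition x <> 1 concerns the outermost letter only: inner integrals
    are evaluated at s < u <= 1, where it holds vacuously. *)
Lemma ccvg_nested_int x n ops u : normc x <= 1 -> (0 < n)%N -> 0 <= u <= 1 ->
  (head false ops -> u = 1 -> x <> 1) ->
  ccvg (psum (word_coef n ops) (x * u%:C))
       (nested_int x (map letter_form ops ++ [:: form_pow n]) u).
Proof.
move=> x1 n0; elim: ops u => [|b ops IH] u u01 ux.
  exact: ccvg_nested_form_pow.
have cG s : 0 < s < u -> ccvg (psum (word_coef n ops) (x * s%:C))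
    (nested_int x (map letter_form ops ++ [:: form_pow n]) s).
  case/andP=> s0 su; have s1 : s < 1 by case/andP: u01 => _; exact: lt_le_trans.
  by apply: IH => [|_ sE]; [rewrite !ltW|rewrite sE ltxx in s1].
have ac := admissible_word_coef ops n0.
case: b ux => ux /=; last exact: ccvg_psum_div.
have [d d0 dx] := one_minus_bounded_below x1 u01 (ux isT).
exact: ccvg_psum_avg d0 dx cG.
Qed.
End NestedIntegrals.

(** * Partial sums and the recursion in n *)

Section PartialSums.
Local Open Scope classical_set_scope.
Local Open Scope complex_scope.
Variable R : realType.
Local Notation C := R[i].
Local Notation normc := (@Normc.normc R).
Implicit Types (x y z t l : C) (u s : R) (c : nat -> R) (rs ms : seq nat).

(* [mcoef n [:: m_p; ...; m_1] k] is the sum of prod_i k_i^(-m_i) over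
   k = k_p > ... > k_1 > n; the list is reversed with respect to the paper. *)
Fixpoint mcoef (n : nat) rs (k : nat) : R :=
  match rs with
  | [::] => (k == n)%:R
  | m :: rs' => (\sum_(j < k) mcoef n rs' j) / k%:R ^+ m
  end.

(** The smallest index k_1, whose exponent m ends the reversed list, is either greater than n + 1 or
    equal to it. *)
Lemma mcoef_rcons n rs m k :
  mcoef n (rcons rs m) k =
    mcoef n.+1 (rcons rs m) k + mcoef n.+1 rs k / n.+1%:R ^+ m.
Proof.
elim: rs k => [|r rs IH] k /=.
  have sumE a : \sum_(j < k) (nat_of_ord j == a)%:R = (a < k)%:R :> R.
    rewrite -[RHS]mulr1 -(sum_delta (fun=> 1 : R)).
    by apply: eq_bigr => j _; rewrite mulr1.
  rewrite !sumE; have [->|kn] := eqVneq k n.+1.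
    by rewrite ltnn ltnSn mul0r add0r.
  by rewrite mul0r addr0 [in RHS]ltn_neqAle eq_sym kn.
under eq_bigr do rewrite IH.
by rewrite big_split /= mulrDl -mulr_suml mulrAC.
Qed.

Lemma psum_mcoef_rcons n rs m x N :
  psum (mcoef n (rcons rs m)) x N = psum (mcoef 0 (rcons rs m)) x N -
    \sum_(a < n) (a.+1%:R ^+ m)^-1 * psum (mcoef a.+1 rs) x N.
Proof.
elim: n => [|n IH]; first by rewrite big_ord0 subr0.
rewrite big_ord_recr /= opprD addrA -IH; apply/eqP; rewrite -subr_eq0 opprB addrC.
apply/eqP; rewrite /psum mulr_sumr -sumrB -big_split /= big1 // => k _.
rewrite (mcoef_rcons n) rmorphD rmorphM fmorphV rmorphXn /= rmorph_nat.
ring.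
Qed.

(** For n = 0 the innermost delta sits at index 0, so j starts at 0; for a nonempty list that term
    is an empty sum. *)
Lemma zeta_n_mcoef a rs : zeta_n a rs = (\sum_(j < a.+1) mcoef 0 rs j)%:C.
Proof.
elim: rs a => [|m rs IH] a /=.
  by rewrite big_ord_recl big1 // addr0.
rewrite big_ord_recl big_ord0 mul0r add0r big_add1 big_mkord rmorph_sum /=.
apply: eq_bigr => j _; rewrite IH /= [in RHS]rmorphM fmorphV rmorphXn /= rmorph_nat.
exact: mulrC.
Qed.

Lemma Li_trunc_mcoef N m rs x :
  Li_trunc N (m :: rs) x = psum (mcoef 0 (m :: rs)) x N.+1.
Proof.
rewrite psumS; last by rewrite /= big_ord0 mul0r.
rewrite /Li_trunc big_add1 big_mkord; apply: eq_bigr => j _.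
rewrite zeta_n_mcoef /= [in RHS]rmorphM fmorphV rmorphXn /= rmorph_nat.
ring.
Qed.

Lemma ccvg_Li m rs x l :
  ccvg (psum (mcoef 0 (m :: rs)) x) l -> Li (m :: rs) x = l.
Proof.
move=> cl; have [lR lI] := iffRL (ccvg_shiftS _ _) cl.
rewrite /Li [RHS]complexE; congr (_ + _ * _); congr (_%:C).
  apply/cvg_lim => //; apply: cvg_trans lR; apply: near_eq_cvg; apply: nearW => N.
  by rewrite Li_trunc_mcoef.
apply/cvg_lim => //; apply: cvg_trans lI; apply: near_eq_cvg; apply: nearW => N.
by rewrite Li_trunc_mcoef.
Qed.

(** Read from the outermost form inwards, a block is m - 1 letters dt/t followed by one dt/(1-t). *)
Definition word_of rs : seq bool :=
  flatten [seq rcons (nseq m.-1 false) true | m <- rs].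

Lemma word_coef_block n q w k :
  word_coef R n (rcons (nseq q false) true ++ w) k =
    (\sum_(j < k) word_coef R n w j) / k%:R ^+ q.+1.
Proof.
elim: q => [//|q IH].
transitivity (word_coef R n (rcons (nseq q false) true ++ w) k / k%:R) => //.
by rewrite IH [in RHS]exprSr invfM -mulrA [X in _ * X]mulrC.
Qed.

(** The factor 1/n from the innermost integral is the one that the prefactor n of the theorem
    cancels. *)
Lemma word_coef_word_of n rs k : all (fun m => 0 < m)%N rs ->
  word_coef R n (word_of rs) k = mcoef n rs k / n%:R.
Proof.
elim: rs k => [//|m rs IH] k /andP[m0 rs0].
rewrite -[word_of _]/(rcons (nseq m.-1 false) true ++ word_of rs).
rewrite word_coef_block prednK //=.
under eq_bigr do rewrite IH //.
by rewrite -mulr_suml mulrAC.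
Qed.

Lemma rev_main_forms n ms :
  rev (main_forms n ms) = map (@letter_form R) (word_of (rev ms)) ++ [:: form_pow n].
Proof.
rewrite /main_forms rev_cons -cats1; congr (_ ++ _).
rewrite rev_flatten -map_comp -map_rev map_flatten -map_comp; congr flatten.
apply: eq_map => m /=; rewrite /block rev_cons map_rcons map_nseq; congr rcons.
elim: m.-1 => [//|q IH].
by rewrite /= rev_cons IH -[form_t :: _]/(nseq q.+1 _) -addn1 nseqD cats1.
Qed.

(** * Limits of the partial sums and induction on the depth p *)

Section fixed_x.
Variable x : C.
Hypothesis x1 : normc x <= 1.

(** The exclusion of (m_p, x) = (1, 1) looks only at the last entry, so it passes to tails; the
    default 0 of [last] lets the empty list qualify. *)
Definition convergent ms :=
  all (fun m => 0 < m)%N ms /\ ~ (last 0%N ms = 1%N /\ x = 1).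

Lemma convergent_cons m ms : convergent (m :: ms) -> convergent ms.
Proof.
case: ms => [|m' ms] [/= /andP[m0 ms0] mx]; split => //.
by case.
Qed.

(* The value at [::] is the one for which [main_value_cons] also covers p = 1. *)
Definition main_value n ms : C :=
  if ms is [::] then x ^+ n else n%:R * iterated_integral x (main_forms n ms).

Lemma ccvg_main_value n ms : (0 < n)%N -> convergent ms ->
  ccvg (psum (mcoef n (rev ms)) x) (main_value n ms).
Proof.
move=> n0; case: ms => [_|m ms].
  apply: near_ccvg (ccvg_delta (fun k => x ^+ k) n); apply: nearW => N.
  by apply: eq_bigr => k _; rewrite rmorph_nat.
move=> [ms0 mx]; rewrite /main_value /iterated_integral rev_main_forms.
(* The outermost letter is dt/(1-t) exactly when m_p = 1, and then x <> 1 by convergence. *)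
have ux : head false (word_of (rev (m :: ms))) -> 1 = 1 :> R -> x <> 1.
  have lE : last 0%N (m :: ms) = head 0%N (rev (m :: ms)).
    by case/lastP: (m :: ms) => // s q; rewrite last_rcons rev_rcons.
  move: mx ms0; rewrite lE -all_rev.
  by case: (rev _) => [|[|[|q]] rs] //= mx _ _ _ xE; exact: mx.
have u01 : 0 <= (1 : R) <= 1 by rewrite ler01 lexx.
have /(ccvgMl n%:R) := ccvg_nested_int x1 n0 u01 ux; rewrite mulr1.
apply: near_ccvg; apply: nearW => N; rewrite /psum mulr_sumr.
apply: eq_bigr => k _; rewrite word_coef_word_of ?all_rev // rmorphM fmorphV /= rmorph_nat.
by field; rewrite pnatr_eq0 -lt0n.
Qed.

(** Convergence of Li, also on the unit circle, comes from the recursion at n = 0: A(0; m, ms) =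
    A(1; m, ms) + A(1; ms), where both terms on the right converge to integrals or to x. *)
Lemma ccvg_Li_main m ms : convergent (m :: ms) ->
  ccvg (psum (mcoef 0 (rev (m :: ms))) x) (Li (rev (m :: ms)) x).
Proof.
move=> cms; have v1 := ccvg_main_value (ltn0Sn 0) cms.
have v2 := ccvg_main_value (ltn0Sn 0) (convergent_cons cms).
have cl : ccvg (psum (mcoef 0 (rev (m :: ms))) x)
    (main_value 1 (m :: ms) + main_value 1 ms).
  apply: near_ccvg (ccvgD v1 v2); apply: nearW => N.
  rewrite rev_cons psum_mcoef_rcons big_ord1 expr1n invr1 mul1r.
  by rewrite subrK.
move: cl; rewrite rev_cons; case E : (rcons _ _) => [|r rs] cl.
  by move/eqP: E; rewrite -size_eq0 size_rcons.
by rewrite (ccvg_Li cl).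
Qed.

(** The telescoped identity in the limit N -> oo; the sum over a is finite, so limits pass
    inside. *)
Lemma main_value_cons n m ms : (0 < n)%N -> convergent (m :: ms) ->
  main_value n (m :: ms) = Li (rev (m :: ms)) x -
    \sum_(a < n) (a.+1%:R ^+ m)^-1 * main_value a.+1 ms.
Proof.
move=> n0 cms; apply: ccvg_unique (ccvg_main_value n0 cms) _.
have cms' := convergent_cons cms.
have cs : ccvg (fun N =>
      \sum_(a < n) (a.+1%:R ^+ m)^-1 * psum (mcoef a.+1 (rev ms)) x N)
    (\sum_(a < n) (a.+1%:R ^+ m)^-1 * main_value a.+1 ms).
  apply: (@ccvg_sum _ n
    (fun a N => (a.+1%:R ^+ m)^-1 * psum (mcoef a.+1 (rev ms)) x N)
    (fun a => (a.+1%:R ^+ m)^-1 * main_value a.+1 ms)) => a _.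
  exact/ccvgMl/ccvg_main_value.
apply: near_ccvg (ccvgB (ccvg_Li_main cms) cs); apply: nearW => N.
by rewrite rev_cons -psum_mcoef_rcons.
Qed.

Lemma zeta_star_n1_cons n m ms : zeta_star_n1 n (m :: ms) =
  \sum_(a < n) (a.+1%:R ^+ m)^-1 * zeta_star_n1 a.+1 ms :> C.
Proof.
rewrite /zeta_star_n1 /= big_add1 big_mkord; apply: eq_bigr => a _.
by rewrite expr1n mul1r.
Qed.

(** Induction on the list for all n at once, since [main_value_cons] involves the shorter list at
    every a + 1 <= n. *)
Lemma main_value_formula n m ms : (0 < n)%N -> convergent (m :: ms) ->
  main_value n (m :: ms) =
  (-1) ^+ (size ms).+1 *
    zeta_star_n n (zip (m :: ms) (rcons (nseq (size ms) 1) x))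
  - \sum_(1 <= j < (size ms).+2)
      (-1) ^+ j * zeta_star_n1 n (take j.-1 (m :: ms)) *
        Li (rev (drop j.-1 (m :: ms))) x.
Proof.
elim: ms m n => [|m' ms IH] m n n0 cms; rewrite main_value_cons //.
  (* For p = 1 the values x^(a+1) at the empty list supply the last argument x of zeta star. *)
  have -> : \sum_(a < n) (a.+1%:R ^+ m)^-1 * main_value a.+1 [::] =
      zeta_star_n n [:: (m, x)].
    by rewrite /= big_add1 big_mkord; apply: eq_bigr => a _; rewrite mulr1 mulrC.
  rewrite big_nat1 -[zip _ _]/[:: (m, x)] -[zeta_star_n1 _ _]/1 drop0; ring.
have cms' := convergent_cons cms.
under eq_bigr => a _ do rewrite IH //.
(* The j = 1 summand is the isolated Li term; the others come from the induction hypothesis. *)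
rewrite [in RHS]big_ltn // [1.-1]/= take0 drop0 -[zeta_star_n1 n [::]]/1.
rewrite expr1 mulr1 mulN1r opprD opprK [in RHS]addrCA; congr (_ + _).
set W := zip (m' :: ms) _.
under eq_bigr do rewrite mulrBr.
rewrite sumrB opprB addrC; congr (_ + _); last first.
  (* Leading terms: the sum over a prefixes (m, 1) to [W], and the minus sign raises the power of
     -1. *)
  rewrite -[zip (m :: _) _]/((m, 1) :: W) /= [in RHS]exprS mulN1r mulNr.
  under eq_bigr do rewrite mulrCA.
  rewrite -mulr_sumr big_add1 big_mkord; congr (- (_ * _)).
  by apply: eq_bigr => a _; rewrite expr1n mul1r.
(* Li terms: after exchanging the sums, term j for the tail becomes term j + 1, its zeta star
   gaining the entry m. *)
under [LHS]eq_bigr do rewrite mulr_sumr.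
rewrite exchange_big /= [in RHS]big_add1 -sumrN; apply: eq_big_nat => j /andP[j1 jn].
case: j j1 jn => // j _ _ /=.
rewrite zeta_star_n1_cons mulr_sumr mulr_suml -sumrN; apply: eq_bigr => a _.
rewrite [(-1) ^+ j.+2]exprS; ring.
Qed.
End fixed_x.
End PartialSums.

Theorem mainTheorem1 (R : realType) (p : nat) (ms : seq nat) (n : nat) (x : R[i]) :
  (1 <= p)%N ->
  size ms = p ->
  all (fun m => 0 < m)%N ms ->
  (0 < n)%N ->
  `|x| <= 1 ->
  ~ (nth 0%N ms p.-1 = 1%N /\ x = 1) ->
  n%:R * iterated_integral x (main_forms n ms)
  = (-1) ^+ p * zeta_star_n n (zip ms (rcons (nseq p.-1 1) x))
    - \sum_(1 <= j < p.+1)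
        (-1) ^+ j * zeta_star_n1 n (take j.-1 ms) * Li (rev (drop j.-1 ms)) x.
Proof.
move=> p_gt0 pE; move: p_gt0; rewrite -{p}pE.
case: ms => [|m ms] // _ ms0 n0 x1 mx.
apply: (@main_value_formula R x _ n m ms n0); first by rewrite -lecR.
by split=> //; move: mx; rewrite nth_last.
Qed.
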